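(* Let $n,m\in\mathbb{N}$ with $m\ge4$, let $\mathbf{p}=(p_x)_{x\in[m]}$ be a probability mass function on $[m]=\{1,\dots,m\}$ with $p_x>0$ for all $x$, let $X_1,\dots,X_n$ be independent with probability mass function $\mathbf{p}$, and let $Y$ be the number of non-isolated balls. Let $\|\mathbf{p}\|:=\sup_{x\in[m]}p_x$ and $\gamma:=\max(n\|\mathbf{p}\|,1)$. Then $$\mathrm{Var}\,Y\le 8n^2\sum_{x=1}^m p_x^2,$$ and if $\|\mathbf{p}\|\le1/11$ and $n\ge 83\,\gamma^2(1+3\gamma+3\gamma^2)e^{1.05\gamma}$, then $$\mathrm{Var}\,Y\ge (7776)^{-1}\gamma^{-2}e^{-2.1\gamma}\,n^2\sum_{x=1}^m p_x^2.$$
   Context: For $1\le i\le n$ let $M_i:=-1+\sum_{j=1}^n\mathbf{1}\{X_j=X_i\}$ (the number of other balls in the same urn as ball $i$). The number of non-isolated balls is $Y:=\sum_{i=1}^n\mathbf{1}\{M_i>0\}$. *)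

(* Defs.v *)
From HB Require Import structures.
From mathcomp Require Import all_boot all_order all_algebra.
From mathcomp Require Import all_classical all_reals all_analysis.

Set Implicit Arguments.
Unset Strict Implicit.
Unset Printing Implicit Defensive.

Import Order.TTheory GRing.Theory Num.Theory.
Local Open Scope classical_set_scope.
Local Open Scope ring_scope.

(* A random variable with values in a set S carrying the discrete sigma-algebra.
   The type {RV P >-> 'I_m} is not available, because a measurableType has to
   be pointed and 'I_m is not for a variable m. *)
Definition discrete_rv d (T : measurableType d) (S : Type) (X : T -> S) : Prop :=
  forall A : set S, measurable (X @^-1` A).

(* The product rule over every subfamily, for events given by arbitrary subsets
   of S, i.e. by the measurable sets of the discrete sigma-algebra. *)
Definition mutually_independent d (T : measurableType d) (R : realType)
    (P : probability T R) (I : finType) (S : Type) (X : I -> T -> S) : Prop :=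
  forall (J : {set I}) (A : I -> set S),
    P (\bigcap_(i in [set` J]) X i @^-1` A i) =
    (\prod_(i in J) P (X i @^-1` A i))%E.

Definition is_pmf (R : realType) (S : finType) (p : S -> R) : Prop :=
  (forall x, 0 <= p x) /\ \sum_x p x = 1.

Definition has_pmf d (T : measurableType d) (R : realType)
    (P : probability T R) (S : finType) (X : T -> S) (p : S -> R) : Prop :=
  forall x, P (X @^-1` [set x]) = (p x)%:E.

(* The number of other balls in the urn of ball i; it is an int rather than a
   nat so that the subtraction of ball i itself is not truncated. *)
Definition others (n m : nat) (T : Type) (X : 'I_n -> T -> 'I_m)
    (i : 'I_n) (w : T) : int :=
  - 1 + \sum_(j < n) (X j w == X i w)%:Z.

Definition non_isolated (R : realType) (n m : nat) (T : Type)
    (X : 'I_n -> T -> 'I_m) (w : T) : R :=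
  \sum_(i < n) (0 < others X i w)%R%:R.

Definition sup_norm (R : realType) (S : finType) (p : S -> R) : R :=
  sup (range p).

Definition gamma (R : realType) (n : nat) (S : finType) (p : S -> R) : R :=
  Num.max (n%:R * sup_norm p) 1.

(* Main.v *)
Require Import Defs.
From mathcomp Require Import all_boot all_order all_algebra.
From mathcomp Require Import all_classical all_reals all_analysis.
From mathcomp Require Import ring lra.
Set Implicit Arguments.
Unset Strict Implicit.
Unset Printing Implicit Defensive.
Import Order.TTheory GRing.Theory Num.Theory.
Local Open Scope classical_set_scope.
Local Open Scope ring_scope.

(* Write I = n - Y for the number of isolated balls, a for the probability that
   a given ball is isolated and b for the probability that two given balls are;
   then Var Y = Var I = n (a - a^2) + n (n - 1) (b - a^2), where
   a = sum_x p_x (1 - p_x)^(n-1) and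
   b = sum_(x <> y) p_x p_y (1 - p_x - p_y)^(n-2).
   Upper bound: 1 - a <= (n - 1) sum p^2, and b - a^2 <= 2 sum p^2 because
   1 - p_x - p_y <= (1 - p_x)(1 - p_y).
   Lower bound: put q = 1 - p, s = q^(n-2), w = q^(n-3), A = sum p s and
   B = sum p^2 s. Bernoulli's inequality, applied to
   1 - p_x - p_y = q_x q_y - p_x p_y, bounds b from below, and completing the
   square leaves the negative term -(A - n B)^2, where A - n B is the p-mean of
   s (1 - n p), so that Jensen's inequality applies. With u = n p, what remains
   is Var Y / n >= sum p q^2 w (1 - w (1 - u + u^2)) - O(1/n) sum p u w.
   As w decays like e^(-u), the bracket is at least u / (10 gamma), so the main
   term dominates the error, and w >= e^(-1.1 gamma) gives a bound stronger
   than the required one. *)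

(** * Elementary inequalities *)

(** Bernoulli's inequality in homogeneous form, so that nothing is divided by [v]. Multiplying the
    induction hypothesis by [v - z >= 0] leaves the surplus [(k + 1) z^2 v^k]. *)
Lemma expr_sub_ge (R : realDomainType) (v z : R) (k : nat) :
  0 <= z <= v -> v ^+ k.+1 - k.+1%:R * z * v ^+ k <= (v - z) ^+ k.+1.
Proof.
move=> /andP[z0 zv]; have v0 : 0 <= v by lra.
elim: k => [|k IH]; first by rewrite !expr1 expr0; lra.
have vk : 0 <= v ^+ k by exact: exprn_ge0.
rewrite [leRHS]exprSr; apply: (le_trans _ (ler_wpM2r _ IH)); last by lra.
rewrite -subr_ge0 !exprSr -[k.+2%:R]natr1 -[k.+1%:R]natr1.
have -> : (v ^+ k * v - (k%:R + 1) * z * v ^+ k) * (v - z) -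
  (v ^+ k * v * v - (k%:R + 1 + 1) * z * (v ^+ k * v)) =
  (k%:R + 1) * z ^+ 2 * v ^+ k by ring.
by rewrite !mulr_ge0 ?sqr_ge0// addr_ge0.
Qed.

Lemma sqr_mean_le (R : realType) (S : finType) (p f : S -> R) :
  is_pmf p ->
  (\sum_x p x * f x) ^+ 2 <= \sum_x p x * f x ^+ 2.
Proof.
move=> [p0 p1]; set mu := \sum_x p x * f x.
have : 0 <= \sum_x p x * (f x - mu) ^+ 2.
  by apply: sumr_ge0 => x _; rewrite mulr_ge0 ?sqr_ge0.
under eq_bigr => x _.
  have -> : p x * (f x - mu) ^+ 2 =
    p x * f x ^+ 2 + (- (2 * mu) * (p x * f x) + mu ^+ 2 * p x) by ring.
  over.
rewrite !big_split/= -!mulr_sumr p1 -/mu; lra.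
Qed.

Lemma sum_offdiag_mul (R : comPzRingType) (S : finType) (f : S -> R) :
  \sum_x \sum_(y | y != x) f x * f y = (\sum_x f x) ^+ 2 - \sum_x f x ^+ 2.
Proof.
rewrite expr2 mulr_suml -sumrB; apply: eq_bigr => x _.
by rewrite mulr_sumr [in RHS](bigD1 x)//= expr2 addrAC subrr add0r.
Qed.

Lemma onem_le_expRN (R : realType) (x : R) : 1 - x <= expR (- x).
Proof. exact: expR_ge1Dx. Qed.

(** With [t = k x / 5], [(1 - x)^k <= e^(-k x) = (e^(-t))^5] and [e^(-t) (1 + t) <= 1]. The fifth
    power stands in for [e^(k x)] and keeps the later estimates polynomial. *)
Lemma onemX_mul_le1 (R : realType) (x : R) (k : nat) : 0 <= x <= 1 ->
  (1 - x) ^+ k * (1 + k%:R * x / 5) ^+ 5 <= 1.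
Proof.
move=> /andP[x0 x1]; set t := k%:R * x / 5.
have t0 : 0 <= t by rewrite !mulr_ge0.
have E : (1 - x) ^+ k <= expR (- t) ^+ 5.
  rewrite -expRM_natl; have -> : 5 * - t = k%:R * - x by rewrite /t; field.
  rewrite expRM_natl lerXn2r ?nnegrE ?expR_ge0 ?onem_le_expRN//; lra.
apply: le_trans (ler_wpM2r _ E) _; first by rewrite exprn_ge0 ?addr_ge0.
rewrite -exprMn exprn_ile1 ?mulr_ge0 ?expR_ge0 ?addr_ge0//.
apply: le_trans (ler_wpM2l (expR_ge0 _) (expR_ge1Dx t)) _.
by rewrite -expRD addNr expR0.
Qed.

(** By [1 + y <= e^y] it is enough that [(1 + c x) (1 - x) >= 1], that is [x <= (c - 1) / c] for
    positive [x]; the bound 1/11 corresponds to [c = 11/10]. *)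
Lemma onem_ge_expRN (R : realType) (x : R) : 0 <= x <= 1 / 11 ->
  expR (- (11 / 10 * x)) <= 1 - x.
Proof.
move=> /andP[x0 x1]; rewrite expRN invf_ple ?posrE ?expR_gt0//; last by lra.
apply: le_trans (expR_ge1Dx _); rewrite -div1r ler_pdivrMr; last by lra.
rewrite -subr_ge0; have -> : (1 + 11 / 10 * x) * (1 - x) - 1 =
  x * (1 - 11 * x) / 10 by field.
by rewrite divr_ge0// mulr_ge0//; lra.
Qed.

(** The terms of degree 4 and 5 in [t] are dropped; for the others, [2/5 (99/100)^2 > 39/100] and
    [2/25 (99/100)^3 > 7/100]. *)
Lemma cubic_le_pow5 (R : realFieldType) (u t : R) :
  0 <= u -> 99 / 100 * u <= t ->
  1 + 99 / 100 * u + 39 / 100 * u ^+ 2 + 7 / 100 * u ^+ 3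
  <= (1 + t / 5) ^+ 5.
Proof.
move=> u0 tu.
have t2 : (99 / 100 * u) ^+ 2 <= t ^+ 2 by rewrite lerXn2r// nnegrE; lra.
have t3 : (99 / 100 * u) ^+ 3 <= t ^+ 3 by rewrite lerXn2r// nnegrE; lra.
have t0 : 0 <= t by lra.
have t4 : 0 <= t ^+ 4 by exact: exprn_ge0.
have t5 : 0 <= t ^+ 5 by exact: exprn_ge0.
have v2 : 0 <= u ^+ 2 by exact: exprn_ge0.
have v3 : 0 <= u ^+ 3 by exact: exprn_ge0.
have -> : (1 + t / 5) ^+ 5 = 1 + t + 2 / 5 * t ^+ 2 + 2 / 25 * t ^+ 3 +
  t ^+ 4 / 125 + t ^+ 5 / 3125 by field.
move: t2 t3; rewrite !exprMn; lra.
Qed.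

(** As [w] is at most the inverse of the fifth power, [1 - u + u^2 <= (1 - h) (1 + r)] suffices,
    where [1 + r] is the cubic of [cubic_le_pow5]. *)
Lemma quad_weight_le (R : realFieldType) (u w t h : R) :
  0 <= u -> 99 / 100 * u <= t -> 0 <= w -> w * (1 + t / 5) ^+ 5 <= 1 ->
  0 <= h <= 1 / 10 -> h <= u / 10 ->
  w * (1 - u + u ^+ 2) <= 1 - h.
Proof.
move=> u0 tu w0 wt /andP[h0 h1] hu.
apply: le_trans (_ : (1 - h) * (w * (1 + t / 5) ^+ 5) <= _); last first.
  by rewrite ler_piMr//; lra.
rewrite mulrCA ler_wpM2l//.
set r := 99 / 100 * u + 39 / 100 * u ^+ 2 + 7 / 100 * u ^+ 3.
have v2 : 0 <= u ^+ 2 by exact: exprn_ge0.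
have v3 : 0 <= u ^+ 3 by exact: exprn_ge0.
have r0 : 0 <= r by rewrite /r; lra.
have hr : 9 / 10 * r <= (1 - h) * r by rewrite ler_wpM2r//; lra.
apply: le_trans (_ : (1 - h) * (1 + r) <= _); last first.
  rewrite ler_wpM2l//; first by lra.
  by apply: le_trans (cubic_le_pow5 u0 tu); rewrite /r; lra.
(* Since [h <= u / 10] and [(1 - h) r >= 9/10 r], the gap is at least
   [u (1.791 - 0.649 u + 0.063 u^2)], and this bracket dominates the square plus 1/10 coefficient by
   coefficient. *)
have : 0 <= u * ((u / 4 - 13 / 10) ^+ 2 + 1 / 10).
  by apply: mulr_ge0 => //; apply: addr_ge0; [exact: sqr_ge0 | lra].
have -> : u * ((u / 4 - 13 / 10) ^+ 2 + 1 / 10) =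
  u ^+ 3 / 16 - 13 / 20 * u ^+ 2 + 179 / 100 * u by field.
have -> : (1 - h) * (1 + r) = 1 - h + (1 - h) * r by ring.
by move: hr; move: ((1 - h) * r) => z; rewrite /r; lra.
Qed.

(** The quadratic term of the cubic alone gives [u^2 w <= 100/39]. *)
Lemma sqr_weight_le (R : realFieldType) (u w t : R) :
  0 <= u -> 99 / 100 * u <= t -> 0 <= w -> w * (1 + t / 5) ^+ 5 <= 1 ->
  u ^+ 2 * w <= 3.
Proof.
move=> u0 tu w0 wt.
have v3 : 0 <= u ^+ 3 by exact: exprn_ge0.
have : w * (39 / 100 * u ^+ 2) <= w * (1 + t / 5) ^+ 5.
  by rewrite ler_wpM2l//; apply: le_trans (cubic_le_pow5 u0 tu); lra.
move: wt; lra.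
Qed.

(** * The explicit variance formula and its upper bound *)

Definition isolated_prob (R : realType) (S : finType) (p : S -> R) (n : nat) : R :=
  \sum_x p x * (1 - p x) ^+ n.-1.

Definition isolated_pair_prob (R : realType) (S : finType) (p : S -> R)
    (n : nat) : R :=
  \sum_x \sum_(y | y != x) p x * p y * (1 - p x - p y) ^+ n.-2.

(* At n = 1 the pair probability is junk (1.-2 = 0), but its factor vanishes. *)
Definition isolated_var (R : realType) (S : finType) (p : S -> R) (n : nat) : R :=
  let a := isolated_prob p n in
  n%:R * (a - a ^+ 2) +
  n%:R * (n%:R - 1) * (isolated_pair_prob p n - a ^+ 2).

Lemma onem_pmf_pair_ge0 (R : realType) (S : finType) (p : S -> R) (x y : S) :
  is_pmf p -> y != x -> 0 <= 1 - p x - p y.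
Proof.
move=> [p0 <-] yx; rewrite (bigD1 x)//= (bigD1 y)//=.
have : 0 <= \sum_(i | (i != x) && (i != y)) p i by exact: sumr_ge0.
lra.
Qed.

Lemma onem_pmf_ge0 (R : realType) (S : finType) (p : S -> R) (x : S) :
  is_pmf p -> 0 <= 1 - p x.
Proof.
move=> [p0 <-]; rewrite (bigD1 x)//=.
have : 0 <= \sum_(i | i != x) p i by exact: sumr_ge0.
lra.
Qed.

Lemma isolated_var_le (R : realType) (S : finType) (p : S -> R) (n : nat) :
  is_pmf p -> isolated_var p n <= 8 * n%:R ^+ 2 * \sum_x p x ^+ 2.
Proof.
move=> pp; have [p0 p1] := pp.
set s2 := \sum_x p x ^+ 2.
have s20 : 0 <= s2 by apply: sumr_ge0 => x _; exact: sqr_ge0.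
(* With at most one ball the formula vanishes; from two balls on, the predecessors in the exponents
   are not truncated. *)
rewrite /isolated_var; case: n => [|[|k]].
- by rewrite !mul0r addr0 !mulr_ge0 ?exprn_ge0.
- have -> : isolated_prob p 1 = 1.
    by rewrite -p1; apply: eq_bigr => x _; rewrite expr0 mulr1.
  by rewrite subrr mulr0 mul0r addr0 expr1n subrr mulr0 !mulr_ge0.
set a := isolated_prob _ _; set b := isolated_pair_prob _ _.
(* [A] is [a] with its exponent lowered to [n - 2], the exponent in [b]; the extra factor [1 - p x]
   of [a] yields [a = A - B]. *)
pose A := \sum_x p x * (1 - p x) ^+ k.
pose B := \sum_x p x ^+ 2 * (1 - p x) ^+ k.
have q01 x j : 0 <= (1 - p x) ^+ j <= 1.
  have := onem_pmf_ge0 x pp; have := p0 x => h1 h2.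
  by rewrite exprn_ge0// exprn_ile1//; lra.
have aAB : a = A - B.
  rewrite /a /isolated_prob /A /B -sumrB; apply: eq_bigr => x _ /=.
  by rewrite exprS; ring.
have A1 : A <= 1.
  rewrite -p1; apply: ler_sum => x _.
  by rewrite ler_piMr//; case/andP: (q01 x k).
have A0 : 0 <= A.
  by apply: sumr_ge0 => x _; rewrite mulr_ge0//; case/andP: (q01 x k).
have B0 : 0 <= B.
  by apply: sumr_ge0 => x _; rewrite mulr_ge0 ?sqr_ge0//; case/andP: (q01 x k).
have Bs : B <= s2.
  apply: ler_sum => x _.
  by rewrite ler_piMr ?sqr_ge0//; case/andP: (q01 x k).
have oa : 1 - a <= k.+1%:R * s2.
  have -> : 1 - a = \sum_x (p x - p x * (1 - p x) ^+ k.+1).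
    by rewrite sumrB p1.
  rewrite mulr_sumr; apply: ler_sum => x _.
  have px1 := onem_pmf_ge0 x pp.
  have := @expr_sub_ge _ 1 (p x) k.
  rewrite p0 -[p x <= 1]subr_ge0 !expr1n mulr1 => /(_ px1).
  move=> h; have : p x * (1 - k.+1%:R * p x) <= p x * (1 - p x) ^+ k.+1.
    by rewrite ler_wpM2l.
  by rewrite expr2; lra.
have bA : b <= A ^+ 2.
  rewrite expr2 /A mulr_suml; apply: ler_sum => x _.
  rewrite mulr_sumr [leRHS](bigD1 x)//=.
  apply: ler_wpDl; first by rewrite !mulr_ge0//; case/andP: (q01 x k).
  apply: ler_sum => y yx; rewrite mulrACA -exprMn.
  rewrite ler_wpM2l ?mulr_ge0//.
  have px0 := p0 x; have py0 := p0 y.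
  have pxy := onem_pmf_pair_ge0 pp yx.
  have pxpy : 0 <= p x * p y by exact: mulr_ge0.
  by rewrite lerXn2r// ?nnegrE; lra.
have n1 : k.+2%:R - 1 = k.+1%:R :> R by rewrite -[k.+2]addn1 natrD addrK.
rewrite n1.
have nn : k.+1%:R <= k.+2%:R :> R by rewrite ler_nat.
have k0 : 0 <= k.+1%:R :> R by [].
move: (k.+1%:R : R) (k.+2%:R : R) nn k0 oa => K N KN K0 oa.
have h1 : a - a ^+ 2 <= K * s2.
  apply: le_trans oa; rewrite -subr_ge0.
  have -> : 1 - a - (a - a ^+ 2) = (1 - a) ^+ 2 by ring.
  exact: sqr_ge0.
(* [b <= A^2] and [a = A - B] leave at most [2 A B], where [A <= 1] and [B <= s2]. *)
have h2 : b - a ^+ 2 <= 2 * s2.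
  apply: le_trans (_ : 2 * A * B <= _).
    rewrite aAB; have := sqr_ge0 B; have -> : (A - B) ^+ 2 =
      A ^+ 2 - 2 * A * B + B ^+ 2 by ring.
    by lra.
  have : A * B <= 1 * s2 by apply: ler_pM.
  by lra.
have h3 : N * (a - a ^+ 2) <= N * (K * s2) by rewrite ler_wpM2l//; lra.
have h4 : N * K * (b - a ^+ 2) <= N * K * (2 * s2).
  by rewrite ler_wpM2l// mulr_ge0//; lra.
have h5 : N * (K * s2) <= N * (N * s2).
  by rewrite ler_wpM2l ?ler_wpM2r//; lra.
have h6 : 0 <= N * (K * s2) by rewrite !mulr_ge0//; lra.
(* The two contributions add up to [3 N K s2], so the constant 8 is met with room to spare. *)
have -> : 8 * N ^+ 2 * s2 = 8 * (N * (N * s2)) by ring.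
have e : N * K * (2 * s2) = 2 * (N * (K * s2)) by ring.
by move: h4; rewrite e; lra.
Qed.

(** * Lower bound for the variance formula *)

(** [expr_sub_ge] is applied with [v = q_x q_y] and [z = p_x p_y], then summed off the diagonal. The
    diagonal of the correction term has a favourable sign and is dropped; that of the product of the
    [q] powers is kept as the subtracted sum of squares. *)
Lemma isolated_pair_prob_ge (R : realType) (S : finType) (p : S -> R) (k : nat) :
  is_pmf p ->
  (\sum_x p x * (1 - p x) ^+ k.+1) ^+ 2 -
  \sum_x (p x * (1 - p x) ^+ k.+1) ^+ 2 -
  k.+1%:R * (\sum_x p x ^+ 2 * (1 - p x) ^+ k) ^+ 2 <= isolated_pair_prob p k.+3.
Proof.
move=> pp; have [p0 _] := pp.
apply: le_trans (_ : \sum_x \sum_(y | y != x)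
    (p x * (1 - p x) ^+ k.+1 * (p y * (1 - p y) ^+ k.+1) -
     k.+1%:R * (p x ^+ 2 * (1 - p x) ^+ k * (p y ^+ 2 * (1 - p y) ^+ k))) <= _).
  under [leRHS]eq_bigr => x _ do rewrite sumrB -[X in _ - X]mulr_sumr.
  rewrite sumrB -[X in _ <= _ - X]mulr_sumr !sum_offdiag_mul.
  rewrite lerD2l lerN2 ler_wpM2l//.
  rewrite lerBlDr lerDl; apply: sumr_ge0 => x _; exact: sqr_ge0.
apply: ler_sum => x _; apply: ler_sum => y yx /=.
have pxy : 0 <= p x * p y by rewrite mulr_ge0.
have h := onem_pmf_pair_ge0 pp yx.
have vz : (1 - p x) * (1 - p y) - p x * p y = 1 - p x - p y by ring.
have zv : 0 <= p x * p y <= (1 - p x) * (1 - p y) by rewrite pxy -subr_ge0 vz.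
have := expr_sub_ge k zv; rewrite vz => {}h.
apply: le_trans (ler_wpM2l pxy h); rewrite !exprMn.
by rewrite le_eqVlt; apply/orP; left; apply/eqP; ring.
Qed.

Lemma isolated_var_decomp_ge (R : realType) (S : finType) (p : S -> R) (k : nat)
    (N := k.+3%:R : R) (w := fun x => (1 - p x) ^+ k) :
  is_pmf p ->
  (\sum_x p x * (1 - p x) ^+ 2 * w x *
     (1 - w x * (1 - N * p x + (N * p x) ^+ 2))) -
  2 * N ^+ 2 * (\sum_x p x ^+ 3 * w x) * (\sum_x p x ^+ 2 * w x) <=
  isolated_var p k.+3 / N.
Proof.
move=> pp; have [p0 _] := pp.
have q01 x j : 0 <= (1 - p x) ^+ j <= 1.
  have := onem_pmf_ge0 x pp; have := p0 x => h1 h2.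
  by rewrite exprn_ge0// exprn_ile1//; lra.
rewrite /isolated_var -/N.
have N3 : 3 <= N by rewrite ler_nat.
have kN1 : k.+1%:R = N - 2 by rewrite /N -[k.+3]addn2 natrD addrK.
set a := isolated_prob p k.+3; set b := isolated_pair_prob p k.+3.
have -> : (N * (a - a ^+ 2) + N * (N - 1) * (b - a ^+ 2)) / N =
  a - a ^+ 2 + (N - 1) * (b - a ^+ 2) by field; lra.
have := isolated_pair_prob_ge k pp; rewrite -/b kN1.
set A := \sum_x p x * (1 - p x) ^+ k.+1.
set Q := \sum_x (p x * (1 - p x) ^+ k.+1) ^+ 2.
set B' := \sum_x p x ^+ 2 * (1 - p x) ^+ k => hb.
pose B := \sum_x p x ^+ 2 * (1 - p x) ^+ k.+1.
set C := \sum_x p x ^+ 3 * w x.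
have aAB : a = A - B.
  rewrite /a /isolated_prob /A /B -sumrB; apply: eq_bigr => x _ /=.
  by rewrite [in LHS]exprS; ring.
have BC : B = B' - C.
  rewrite /B /B' /C -sumrB; apply: eq_bigr => x _ /=.
  by rewrite [(1 - p x) ^+ k.+1]exprS /w; ring.
have B0 : 0 <= B.
  by apply: sumr_ge0 => x _; rewrite mulr_ge0 ?sqr_ge0//; case/andP: (q01 x k.+1).
have C0 : 0 <= C.
  apply: sumr_ge0 => x _; apply: mulr_ge0; first exact: exprn_ge0.
  by case/andP: (q01 x k).
have J : (A - N * B) ^+ 2 <=
    \sum_x p x * ((1 - p x) ^+ k.+1 * (1 - N * p x)) ^+ 2.
  have -> : A - N * B = \sum_x p x * ((1 - p x) ^+ k.+1 * (1 - N * p x)).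
    rewrite /A /B mulr_sumr -sumrB; apply: eq_bigr => x _.
    by ring.
  exact: sqr_mean_le.
set J' := \sum_x _ in J.
(* With [u = N p x], the Jensen term contributes [(1 - u)^2] and [Q] contributes [u - p x]; together
   they make [1 - u + u^2] up to the surplus [(p q w)^2]. *)
have E : \sum_x p x * (1 - p x) ^+ 2 * w x *
    (1 - w x * (1 - N * p x + (N * p x) ^+ 2)) <= a - (N - 1) * Q - J'.
  rewrite /a /isolated_prob /Q /J' mulr_sumr -!sumrB; apply: ler_sum => x _.
  rewrite /= !exprS -/(w x) -subr_ge0 expr0.
  have -> : p x * ((1 - p x) * ((1 - p x) * w x)) -
      (N - 1) * (p x * ((1 - p x) * w x) * (p x * ((1 - p x) * w x) * 1)) -
      p x * ((1 - p x) * w x * (1 - N * p x) *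
             ((1 - p x) * w x * (1 - N * p x) * 1)) -
      p x * ((1 - p x) * ((1 - p x) * 1)) * w x *
      (1 - w x * (1 - N * p x + N * p x * (N * p x * 1))) =
      (p x * ((1 - p x) * w x)) ^+ 2 by ring.
  exact: sqr_ge0.
have F : 0 <= (N - 1) * B ^+ 2 by rewrite mulr_ge0 ?sqr_ge0//; lra.
have H1 : (N - 1) * (b - a ^+ 2) >=
  (N - 1) * (A ^+ 2 - Q - (N - 2) * B' ^+ 2 - a ^+ 2).
  by rewrite ler_wpM2l//; lra.
(* Here [B <= B'], as [C >= 0]. *)
have H2 : (N - 1) * (N - 2) * (C * (B + B')) <= N ^+ 2 * (C * (2 * B')).
  apply: ler_pM.
  - by apply: mulr_ge0; lra.
  - by apply: mulr_ge0 => //; lra.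
  - have -> : (N - 1) * (N - 2) = N ^+ 2 - (N * 3 - 2) by ring.
    lra.
  - by rewrite ler_wpM2l//; lra.
(* Uses [B'^2 - B^2 = C (B + B')]; completing the square leaves
   [N^2 - N - (N - 1) (N - 2) = 2 (N - 1)] copies of [B^2], which are nonnegative. *)
have e : a - a ^+ 2 + (N - 1) * (A ^+ 2 - Q - (N - 2) * B' ^+ 2 - a ^+ 2) =
  a - (N - 1) * Q - (A - N * B) ^+ 2 + 2 * ((N - 1) * B ^+ 2) -
    (N - 1) * (N - 2) * (C * (B + B')).
  by rewrite aAB BC; ring.
have -> : 2 * N ^+ 2 * C * B' = N ^+ 2 * (C * (2 * B')) by ring.
lra.
Qed.

Lemma isolated_var_ge (R : realType) (S : finType) (p : S -> R) (n : nat) (g : R) :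
  is_pmf p -> (forall x, p x <= 1 / 11) -> 1 <= g ->
  (forall x, n%:R * p x <= g) -> 581 * g ^+ 2 <= n%:R ->
  7 / 100 / g * expR (- (11 / 10 * g)) * n%:R ^+ 2 * \sum_x p x ^+ 2 <=
  isolated_var p n.
Proof.
move=> pp p11 g1 npg; have [p0 p1] := pp.
have g2 : g <= g ^+ 2 by rewrite expr2 ler_peMl//; lra.
have g0 : 0 < g by lra.
(* Fewer than three balls contradict [581 <= 581 g^2 <= n]. *)
case: n npg => [|[|[|k]]] npg Ng; rewrite ?expr0n//=; try by lra.
have := isolated_var_decomp_ge k pp.
set N := k.+3%:R in npg Ng *.
have Nk : k%:R = N - 3 by rewrite /N -[k.+3]addn3 natrD addrK.
have N0 : 0 < N by lra.
set D := \sum_x p x ^+ 2 * _; set s2 := \sum_x p x ^+ 2.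
pose w x := (1 - p x) ^+ k.
have q0 x : 0 <= 1 - p x by exact: onem_pmf_ge0.
have w0 x : 0 <= w x by exact: exprn_ge0.
have D0 : 0 <= D by apply: sumr_ge0 => x _; rewrite mulr_ge0 ?sqr_ge0// w0.
have u0 x : 0 <= N * p x by rewrite mulr_ge0// ltW.
(* [k = N - 3], and [N >= 581] makes the loss of 3 smaller than one percent. *)
have tu x : 99 / 100 * (N * p x) <= k%:R * p x.
  by rewrite mulrA ler_wpM2r// Nk; lra.
have wt x : w x * (1 + k%:R * p x / 5) ^+ 5 <= 1.
  by apply: onemX_mul_le1; rewrite p0 -subr_ge0 q0.
(* [quad_weight_le] is used with [h = u / (10 g)]: [u <= g] gives [h <= 1/10] and [g >= 1] gives
   [h <= u / 10]. The constant is [1/10] times the lower bound [(10/11)^2] for [q^2]. *)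
have main : 10 / 121 * (N / g * D) <= \sum_x p x * (1 - p x) ^+ 2 * w x *
    (1 - w x * (1 - N * p x + (N * p x) ^+ 2)).
  rewrite /D !mulr_sumr; apply: ler_sum => x _.
  have hg : N * p x / (10 * g) <= 1 / 10.
    by rewrite ler_pdivrMr ?mulr_gt0//; have := npg x; lra.
  have h0 : 0 <= N * p x / (10 * g) by rewrite divr_ge0// mulr_ge0// ltW.
  have hu : N * p x / (10 * g) <= N * p x / 10.
    rewrite ler_wpM2l// lef_pV2 ?posrE ?mulr_gt0//; lra.
  have := quad_weight_le (u0 x) (tu x) (w0 x) (wt x) _ hu.
  rewrite h0 hg => /(_ isT) H.
  apply: le_trans (_ : p x * (1 - p x) ^+ 2 * w x * (N * p x / (10 * g)) <= _).
    have qq : 100 / 121 <= (1 - p x) ^+ 2.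
      have -> : 100 / 121 = (10 / 11) ^+ 2 :> R by field.
      by rewrite lerXn2r ?nnegrE//; have := p11 x; lra.
    have -> : p x * (1 - p x) ^+ 2 * w x * (N * p x / (10 * g)) =
      (1 - p x) ^+ 2 * (p x * w x * (N * p x / (10 * g))) by ring.
    have -> : 10 / 121 * (N / g * (p x ^+ 2 * (1 - p x) ^+ k)) =
      100 / 121 * (p x * w x * (N * p x / (10 * g))).
      by rewrite /w; field; rewrite gt_eqF.
    rewrite ler_wpM2r//; apply: mulr_ge0 => //.
    exact: mulr_ge0 (p0 x) (w0 x).
  rewrite ler_wpM2l//; last by lra.
  by apply: mulr_ge0 (w0 x); rewrite mulr_ge0 ?sqr_ge0.
(* Two powers of [N] turn [p^3 w] into [p u^2 w], whose sum is at most 3. The resulting [6 D] is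
   small against [N / g * D] because [N / g >= 581 g >= 581]. *)
have err : 2 * N ^+ 2 * (\sum_x p x ^+ 3 * w x) * D <= 6 / 581 * (N / g * D).
  apply: le_trans (_ : 6 * D <= _).
    rewrite ler_wpM2r//.
    have -> : 2 * N ^+ 2 * (\sum_x p x ^+ 3 * w x) =
      2 * (\sum_x p x * ((N * p x) ^+ 2 * w x)).
      rewrite -mulrA !mulr_sumr; apply: eq_bigr => x _.
      by rewrite exprMn; ring.
    have : \sum_x p x * ((N * p x) ^+ 2 * w x) <= \sum_x p x * 3.
      apply: ler_sum => x _; rewrite ler_wpM2l//.
      exact: sqr_weight_le (u0 x) (tu x) (w0 x) (wt x).
    by rewrite -mulr_suml p1; lra.
  rewrite mulrA ler_wpM2r//.
  have : 581 * g <= N / g * g by rewrite divfK ?gt_eqF//; lra.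
  by rewrite ler_pM2r//; lra.
have Ds : expR (- (11 / 10 * g)) * s2 <= D.
  rewrite /D mulr_sumr; apply: ler_sum => x _.
  rewrite mulrC ler_wpM2l ?sqr_ge0//.
  apply: le_trans (_ : expR (- (11 / 10 * p x)) ^+ k <= _).
    rewrite -expRM_natl ler_expR.
    have : k%:R * p x <= N * p x by rewrite ler_wpM2r// Nk; lra.
    by have := npg x; lra.
  by rewrite lerXn2r ?nnegrE ?expR_ge0// onem_ge_expRN// p0 p11.
move=> lb.
have Dg : 0 <= N / g * D by rewrite mulr_ge0// divr_ge0// ltW.
have {}lb := le_trans (lerB main err) lb.
(* [10/121 - 6/581 > 7/100]. *)
have {}lb : 7 / 100 * (N / g * D) <= isolated_var p k.+3 / N.
  by move: lb Dg; move: (isolated_var _ _ / N) (N / g * D) => v z; lra.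
move: lb; rewrite ler_pdivlMr//; apply: le_trans.
have -> : 7 / 100 / g * expR (- (11 / 10 * g)) * N ^+ 2 * s2 =
  7 / 100 * (N / g * (expR (- (11 / 10 * g)) * s2)) * N by ring.
apply: ler_wpM2r; first exact: ltW.
apply: ler_wpM2l; first by lra.
by apply: ler_wpM2l Ds; rewrite divr_ge0 ?ltW.
Qed.

(** Weakens the rate of [isolated_var_ge] to the stated one: for [g >= 1] both [g^(-1)] and
    [e^(-1.1 g)] only decrease when replaced by [g^(-2)] and [e^(-2.1 g)]. *)
Lemma rate_le (R : realType) (c g N s : R) : 0 <= c <= 7 / 100 -> 1 <= g -> 0 <= s ->
  c * g ^- 2 * expR (- (21 / 10 * g)) * N ^+ 2 * s <=
  7 / 100 / g * expR (- (11 / 10 * g)) * N ^+ 2 * s.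
Proof.
move=> /andP[c0 c7] g1 s0; rewrite ler_wpM2r// ler_wpM2r ?sqr_ge0//.
have g0 : 0 < g by lra.
have gg : 0 < g ^+ 2 by exact: exprn_gt0.
apply: ler_pM.
- by rewrite mulr_ge0// invr_ge0 ltW.
- exact: expR_ge0.
- apply: ler_pM => //; first by rewrite invr_ge0 ltW.
  by rewrite lef_pV2 ?posrE// expr2 ler_peMl// ltW.
- by rewrite ler_expR; lra.
Qed.

(** * Variance of a sum of indicators *)

Lemma expectation_sum_indic (R : realType) d (T : measurableType d)
    (P : probability T R) (K : finType) (F : K -> set T) :
  (forall k, measurable (F k)) ->
  (fun w => \sum_k \1_(F k) w : R) \in Lfun P 1 /\
  ('E_P[fun w => (\sum_k \1_(F k) w)%R : R] = \sum_k P (F k))%E.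
Proof.
move=> mF.
have L k : (\1_(F k) : T -> R) \in Lfun P 1.
  by apply/Lfun1_integrable; exact: integrable_indic.
have e : (fun w => \sum_k \1_(F k) w : R) =
    \sum_(f <- [seq (\1_(F k) : T -> R) | k <- index_enum K]) f.
  by rewrite big_map; apply/funext => w; rewrite fct_sumE.
split.
  by rewrite e big_map rpred_sum.
rewrite e expectation_sum ?big_map; last by move=> f /mapP[k _ ->].
by apply: eq_bigr => k _; rewrite expectation_indic.
Qed.

(** Integrability makes the mean finite, so the deviation of [c - f] is pointwise the negative of
    that of [f], and the squares agree. *)
Lemma variance_cst_sub (R : realType) d (T : measurableType d)
    (P : probability T R) (c : R) (f : T -> R) :
  f \in Lfun P 1 -> ('V_P[fun w => (c - f w)%R] = 'V_P[f])%E.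
Proof.
move=> fL; rewrite /variance unlock.
have -> : (fun w => c - f w) = cst c \- f by [].
rewrite expectationB ?Lfun_cst// expectation_cst.
have := expectation_fin_num fL; case: ('E_P[f])%E => // r _ /=.
congr expectation; apply/funext => w.
by rewrite !fctE /= -mulrNN; congr (_ * _); ring.
Qed.

Lemma variance_cst_sub_sum_indic (R : realType) d (T : measurableType d)
    (P : probability T R) (K : finType) (F : K -> set T) (c : R)
    (a : K -> R) (b : K -> K -> R) :
  (forall k, measurable (F k)) -> (forall k, P (F k) = (a k)%:E) ->
  (forall k l, P (F k `&` F l) = (b k l)%:E) ->
  ('V_P[fun w => (c - \sum_k \1_(F k) w)%R] =
   (\sum_k \sum_l b k l - (\sum_k a k) ^+ 2)%:E)%E.
Proof.
move=> mF Pa Pb; have [L1 E1] := expectation_sum_indic P mF.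
rewrite variance_cst_sub// /variance.
have mF2 (kl : K * K) : measurable (F kl.1 `&` F kl.2) by exact: measurableI.
have [L2 E2] := expectation_sum_indic P mF2.
(* The square of the count is the count of ordered pairs of events that both occur, diagonal pairs
   included. *)
have e : ((fun w => \sum_k \1_(F k) w : R) * (fun w => \sum_k \1_(F k) w : R)) =
    (fun w => \sum_(kl : K * K) \1_(F kl.1 `&` F kl.2) w : R).
  apply/funext => w; rewrite fctE/= mulr_suml.
  rewrite -(pair_bigA _ (fun k l => \1_(F k `&` F l) w))/=.
  by apply: eq_bigr => k _; rewrite mulr_sumr; apply: eq_bigr => l _; rewrite indicI.
rewrite covarianceE ?e// E2 E1.
under eq_bigr do rewrite Pb.
under [in X in (_ - X)%E]eq_bigr do rewrite Pa.
rewrite !sumEFin -EFinM -EFinB expr2; congr ((_ - _)%:E).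
by rewrite (pair_bigA _ b).
Qed.

(** * Isolation events and their probabilities *)

Definition isolated_ball (T S I : Type) (X : I -> T -> S) (i : I) : set T :=
  [set w | forall j, j <> i -> X j w <> X i w].

Lemma non_isolatedE (R : realType) (n m : nat) (T : Type) (X : 'I_n -> T -> 'I_m)
    (w : T) :
  non_isolated R X w = n%:R - \sum_i \1_(isolated_ball X i) w.
Proof.
have -> : n%:R = \sum_(i < n) (1 : R) by rewrite sumr_const card_ord.
rewrite /non_isolated -sumrB; apply: eq_bigr => i _.
rewrite indicE; case: (boolP (w \in _)) => [/set_mem iso|/negP niso].
  (* The [- 1] in [others] cancels the term of ball [i] itself. *)
  rewrite subrr /others (bigD1 i)//= eqxx addrA addNr add0r big1// => j /eqP ji.
  by case: eqP => // /(iso _ ji).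
rewrite subr0; suff -> : 0 < others X i w by [].
have [j ji Xji] : exists2 j, j != i & X j w == X i w.
  apply: contra_notP niso => no; apply/mem_set => j /eqP ji /eqP Xji.
  by apply: no; exists j.
rewrite /others (bigD1 i)//= eqxx addrA addNr add0r (bigD1 j)//= Xji.
by rewrite ltr_pwDl// sumr_ge0.
Qed.

Lemma measure_bigcup_fin d (T : measurableType d) (R : realType)
    (mu : {measure set T -> \bar R}) (K : finType) (F : K -> set T) :
  (forall k, measurable (F k)) -> trivIset setT F ->
  (mu (\bigcup_k F k) = \sum_k mu (F k))%E.
Proof.
move=> mF tF; rewrite measure_fin_bigcup//.
rewrite (fsbigE (index_enum K)) ?index_enum_uniq//; last first.
- by move=> k _ /negP[]; exact: mem_index_enum.
- by apply: eq_bigl => k; rewrite in_setT.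
- exact: finite_finset.
Qed.

Section occupancy.
Context (R : realType) d (T : measurableType d) (P : probability T R).
Context (S I : finType) (p : S -> R) (X : I -> T -> S).
Hypotheses (mX : forall i, discrete_rv (X i))
  (indX : mutually_independent P X) (lawX : forall i, has_pmf P (X i) p).

Lemma prob_box (A : I -> set S) :
  P (\bigcap_i X i @^-1` A i) = (\prod_i P (X i @^-1` A i))%E.
Proof.
have := indX [set: I]%SET A.
rewrite (_ : [set` [set: I]%SET] = [set: I]); last first.
  by apply/seteqP; split => // i _ /=; rewrite inE.
by move=> ->; apply: eq_bigl => i; rewrite inE.
Qed.

Lemma measurable_box (A : I -> set S) : measurable (\bigcap_i X i @^-1` A i).
Proof. by apply: fin_bigcap_measurable => // i _; exact: mX. Qed.

Lemma prob_avoid1 (i : I) (x : S) : P (X i @^-1` (~` [set x])) = (1 - p x)%:E.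
Proof.
rewrite -preimage_setC probability_setC; last exact: mX.
by rewrite (lawX i x) -EFinB.
Qed.

Lemma prob_avoid2 (i : I) (x y : S) : x != y ->
  P (X i @^-1` (~` [set x; y])) = (1 - p x - p y)%:E.
Proof.
move=> xy; rewrite -preimage_setC probability_setC; last exact: mX.
have disj : X i @^-1` [set x] `&` X i @^-1` [set y] = set0.
  by apply/seteqP; split => // w /= [-> /eqP]; rewrite (negPf xy).
suff -> : P (X i @^-1` [set x; y]) = (p x + p y)%:E.
  by rewrite -EFinB opprD addrA.
rewrite EFinD -(lawX i x) -(lawX i y) preimage_setU.
exact: measureU (mX i _) (mX i _) disj.
Qed.

(** Splitting by the urn [x] of ball [i] gives disjoint boxes, to each of which the product rule
    applies. *)
Lemma isolated_ball_bigcup (i : I) : isolated_ball X i =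
  \bigcup_x \bigcap_j X j @^-1` (if j == i then [set x] else ~` [set x]).
Proof.
apply/seteqP; split => w /=.
  by move=> iso; exists (X i w) => // j _ /=; case: eqP => [->//|/iso].
move=> [x _ h] j /eqP ji; have := h i Logic.I; have := h j Logic.I.
by rewrite /= eqxx (negPf ji) => jx ->.
Qed.

Lemma measurable_isolated (i : I) : measurable (isolated_ball X i).
Proof.
rewrite isolated_ball_bigcup.
by apply: fin_bigcup_measurable => // x _; exact: measurable_box.
Qed.

Lemma prob_isolated (i : I) : P (isolated_ball X i) = (isolated_prob p #|I|)%:E.
Proof.
rewrite isolated_ball_bigcup measure_bigcup_fin.
- rewrite /isolated_prob -sumEFin; apply: eq_bigr => x _.
  etransitivity; first exact: prob_box.
  rewrite (bigD1 i)//= eqxx (lawX i x).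
  under eq_bigr => j /negPf ji do rewrite ji prob_avoid1.
  by rewrite prodEFin prodr_const cardC1 EFinM.
- by move=> x; exact: measurable_box.
- move=> x y _ _ [w [/(_ i Logic.I) + /(_ i Logic.I)]] /=.
  by rewrite eqxx => <- <-.
Qed.

Lemma prob_isolated_pair (i k : I) : i != k ->
  P (isolated_ball X i `&` isolated_ball X k) = (isolated_pair_prob p #|I|)%:E.
Proof.
move=> ik; have ki : k != i by rewrite eq_sym.
(* The pieces are indexed by the urns of the two balls; the diagonal is empty because balls sharing
   an urn are not isolated. *)
pose F (xy : S * S) := if xy.1 == xy.2 then set0 else \bigcap_j X j @^-1`
  (if j == i then [set xy.1] else if j == k then [set xy.2]
   else ~` [set xy.1; xy.2]).
have -> : isolated_ball X i `&` isolated_ball X k = \bigcup_xy F xy.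
  apply/seteqP; split => w /=.
    move=> [isoi isok]; exists (X i w, X k w) => //; rewrite /F /=.
    case: eqP => [/isok|_ j _ /=]; first by move/eqP : ik => ik /(_ ik).
    case: eqP => [->//|ji]; case: eqP => [->//|jk] /=.
    by case; [exact: isoi|exact: isok].
  move=> [[x y] _]; rewrite /F/=; case: eqP => // xy h.
  have := h i Logic.I; have := h k Logic.I; rewrite /= !eqxx (negPf ki) => Xk Xi.
  split => j /eqP ji; have := h j Logic.I; rewrite /= (negPf ji) ?Xi ?Xk.
    by case: ifP => [_ ->|_ /not_orP[]//]; exact/nesym.
  by case: ifP => [_ ->//|_ /not_orP[]//].
rewrite measure_bigcup_fin.
- rewrite /isolated_pair_prob -(pair_bigA _ (fun x y => P (F (x, y))))/=.
  rewrite -sumEFin; apply: eq_bigr => x _; rewrite -sumEFin.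
  rewrite (bigD1 x)//= {1}/F/= eqxx measure0 add0e; apply: eq_bigr => y yx.
  rewrite /F/= eq_sym (negPf yx).
  etransitivity; first exact: prob_box.
  rewrite (bigD1 i)//= eqxx (lawX i x).
  rewrite (bigD1 k ki)/= (negPf ki) eqxx (lawX k y).
  under eq_bigr => j /andP[/negPf ji /negPf jk].
    rewrite ji jk prob_avoid2 1?eq_sym//; over.
  rewrite prodEFin prodr_const -!EFinM mulrA; congr (_ * _ ^+ _)%:E.
  (* The exponent counts the balls other than [i] and [k]. *)
  rewrite -subn2; transitivity #|~: [set i; k]%SET|.
    by apply: eq_card => j; rewrite !inE negb_or.
  by rewrite cardsCs finset.setCK cards2 ik.
- by move=> xy; rewrite /F; case: ifP => // _; exact: measurable_box.
- move=> [x y] [x' y'] _ _; rewrite /F/=.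
  case: eqP; first by rewrite set0I => _ [].
  move=> _; case: eqP; first by rewrite setI0 => _ [].
  move=> _ [w [h h']]; have := h i Logic.I; have := h' i Logic.I.
  have := h k Logic.I; have := h' k Logic.I; rewrite /= !eqxx (negPf ki).
  by move=> <- <- <- <-.
Qed.
End occupancy.

(** * The variance of the number of non-isolated balls *)

Lemma variance_non_isolated (R : realType) d (T : measurableType d)
    (P : probability T R) (n m : nat) (p : 'I_m -> R) (X : 'I_n -> T -> 'I_m) :
  (forall i, discrete_rv (X i)) -> mutually_independent P X ->
  (forall i, has_pmf P (X i) p) ->
  ('V_P[non_isolated R X] = (isolated_var p n)%:E)%E.
Proof.
move=> mX indX lawX.
rewrite (_ : non_isolated R X = fun w => n%:R - \sum_i \1_(isolated_ball X i) w);
  last by apply/funext => w; exact: non_isolatedE.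
pose a := isolated_prob p n; pose b := isolated_pair_prob p n.
rewrite (@variance_cst_sub_sum_indic _ _ _ _ _ _ _ (fun=> a)
  (fun k l => if l == k then a else b)); first last.
- move=> k l; case: eqVneq => [->|lk].
    by rewrite setIid (prob_isolated mX indX lawX) card_ord.
  by rewrite (prob_isolated_pair mX indX lawX) 1?eq_sym// card_ord.
- by move=> k; rewrite (prob_isolated mX indX lawX) card_ord.
- by move=> k; exact: measurable_isolated.
congr (_%:E).
have row k : \sum_(l < n) (if l == k then a else b) = a + (n%:R - 1) * b.
  rewrite (bigD1 k)//= eqxx; congr (_ + _).
  rewrite (eq_bigr (fun=> b)) => [|l /negPf->//].
  rewrite sumr_const cardC1 card_ord -[b *+ _]mulr_natl; congr (_ * _).
  (* The existence of [k] forces [n > 0], so the natural predecessor of [n] agrees with [n - 1] in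
     [R]. *)
  by case: (n) k => [[]//|j _]; rewrite -[j.+1]addn1 natrD addrK addn1.
under eq_bigr do rewrite row.
rewrite !sumr_const card_ord -[a *+ n]mulr_natl -[(_ + _) *+ n]mulr_natl.
by rewrite /isolated_var -/a -/b; ring.
Qed.

Unset Implicit Arguments.

Theorem theorem4 (R : realType) (d : measure_display) (T : measurableType d)
    (P : probability T R) (n m : nat) (hm : (4 <= m)%N)
    (p : 'I_m -> R) (hp : is_pmf p) (hp0 : forall x : 'I_m, 0 < p x)
    (X : 'I_n -> T -> 'I_m) (hX : forall i : 'I_n, discrete_rv (X i))
    (hind : mutually_independent P X)
    (hlaw : forall i : 'I_n, has_pmf P (X i) p) :
  ('V_P[non_isolated R X]
     <= (8 * n%:R ^+ 2 * \sum_(x < m) p x ^+ 2)%:E)%E /\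
  (sup_norm p <= 1 / 11 ->
   83 * gamma n p ^+ 2 * (1 + 3 * gamma n p + 3 * gamma n p ^+ 2)
      * expR (105 / 100 * gamma n p) <= n%:R ->
   ((7776^-1 * gamma n p ^- 2 * expR (- (21 / 10 * gamma n p))
       * n%:R ^+ 2 * \sum_(x < m) p x ^+ 2)%:E
     <= 'V_P[non_isolated R X])%E).
Proof.
rewrite (variance_non_isolated hX hind hlaw); split.
  by rewrite lee_fin; exact: isolated_var_le.
move=> p11 hn; rewrite lee_fin.
have p_sup x : p x <= sup_norm p.
  apply: ub_le_sup; last by exists x.
  (* [sup] is a true upper bound only for a set bounded above; here 1 bounds every [p x]. *)
  exists 1 => _ [y _ <-]; rewrite -subr_ge0; exact: onem_pmf_ge0.
set g := gamma n p in hn *.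
have g1 : 1 <= g by rewrite le_max lexx orbT.
apply: le_trans (isolated_var_ge hp _ g1 _ _).
- apply: rate_le => //; last by apply: sumr_ge0 => x _; exact: sqr_ge0.
  by apply/andP; split; lra.
- by move=> x; exact: le_trans p11.
- by move=> x; rewrite le_max ler_wpM2l ?p_sup.
apply: le_trans hn; have g2 : 1 <= g ^+ 2 by exact: exprn_ege1.
(* For [g >= 1] the factor [1 + 3 g + 3 g^2] is at least 7 and the exponential at least 1, whence
   [581 = 83 * 7]. *)
have -> : 581 * g ^+ 2 = 83 * g ^+ 2 * 7 * 1 by ring.
have c0 : 0 <= 83 * g ^+ 2 by lra.
apply: ler_pM => //.
- by apply: mulr_ge0 => //; lra.
- by rewrite ler_wpM2l//; lra.
- by apply: le_trans (expR_ge1Dx _); lra.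
Qed.
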